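(* Let $k\ge4$ and $B\ge1$ be integers. For every max-min $B$-bounded space $k$-cardinality constrained algorithm $ALG$ and every positive integer $m$ with $m\ge(k-1)B$ and $m$ divisible by both $3$ and $k-1$, there exists a sorted item sequence $I$ such that $OPT_k(I)=m$ and: (A) if $4\le k\le6$, $ALG(I)\ge\left(\frac53-\frac{1}{k-1}\right)\cdot OPT_k(I)-\frac16B(k+5)$; (B) if $k=7$, $ALG(I)\ge\frac32\cdot OPT_k(I)-2B$; (C) if $k\ge8$, $ALG(I)\ge\frac32\cdot OPT_k(I)-\frac12B$.
   Context: The $k$-cardinality constrained bin packing problem: an item sequence $I=(a_1,\dots,a_n)\in(0,1]^n$ must be packed into bins of capacity $1$ with at most $k$ items per bin; $OPT_k(I)$ is the minimum number of non-empty bins, $ALG(I)$ the number used by $ALG$. A $k$-cardinality constrained algorithm always outputs packings with at most $k$ items per bin. $I$ is sorted if $a_1\ge\cdots\ge a_n$. A max-min algorithm first sorts the input in non-increasing order and then repeatedly takes either the head (largest) or tail (smallest) item of the currently remaining sorted sequence and packs it into a bin, each decision depending only on items already packed and the current head and tail items, without seeing other remaining items. A bin is open if it contains an item and may still receive items; closed bins never receive further items. A $B$-bounded space algorithm keeps at most $B$ open bins at any time. *)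

(* Defs.v *)
From HB Require Import structures.
From mathcomp Require Import all_boot all_order all_algebra.
Set Implicit Arguments. Unset Strict Implicit. Unset Printing Implicit Defensive.
Import Order.TTheory GRing.Theory Num.Theory.
Local Open Scope ring_scope.

Section BinPacking.
Variable R : realFieldType.

Definition items_ok (I : seq R) : bool := all (fun x => (0 < x) && (x <= 1)) I.

Definition sorted_items (I : seq R) : bool := sorted (fun x y => y <= x) I.

Definition feasible_k (k : nat) (I : seq R) (b : nat) : Prop :=
  exists f : 'I_(size I) -> nat,
    (forall i, (f i < b)%N) /\
    (forall j, (j < b)%N ->
        (\sum_(i < size I | f i == j) I`_i <= 1) /\
        (#|[set i : 'I_(size I) | f i == j]| <= k)%N).

Definition opt_k (k : nat) (I : seq R) (m : nat) : Prop :=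
  feasible_k k I m /\ forall b, feasible_k k I b -> (m <= b)%N.

(* a bin: its items (in packing order) and whether it is still open *)
Definition bin := (seq R * bool)%type.
Definition config := seq bin.

(* one decision: which bins (indices) to close first, whether to take the
   head (largest, true) or the tail (smallest, false) of the remaining sorted
   sequence, and where to put it (Some j = existing bin j, None = new bin). *)
Record decision := Decision {
  dclose : seq nat;
  dhead : bool;
  dtarget : option nat }.

(* a (deterministic) max-min algorithm: its decision depends only on the
   current packing of the already packed items and on the current head and
   tail items. *)
Definition maxmin_alg := config -> R -> R -> decision.

Definition n_open (c : config) : nat := count (fun b : bin => b.2) c.

Definition close_bins (cs : seq nat) (c : config) : config :=
  mkseq (fun i => let b := nth ([::], false) c i in (b.1, b.2 && (i \notin cs)))
        (size c).

Definition place (k : nat) (x : R) (tgt : option nat) (c : config) : option config :=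
  match tgt with
  | None => Some (rcons c ([:: x], true))
  | Some j =>
      let b := nth ([::], false) c j in
      if [&& (j < size c)%N, b.2, (\sum_(y <- b.1) y) + x <= 1 & (size b.1 < k)%N]
      then Some (set_nth ([::], false) c j (rcons b.1 x, true))
      else None
  end.

Fixpoint run (k B : nat) (A : maxmin_alg) (fuel : nat) (c : config) (rem : seq R)
  : option config :=
  match fuel with
  | O => Some c
  | S fuel' =>
    match rem with
    | [::] => Some c
    | h :: s =>
      let t := last h s in
      let d := A c h t in
      let x := if dhead d then h else t in
      let rem' := if dhead d then s else belast h s in
      match place k x (dtarget d) (close_bins (dclose d) c) with
      | None => None
      | Some c' => if (n_open c' <= B)%N then run k B A fuel' c' rem' else None
      end
    end
  end.

Definition run_alg (k B : nat) (A : maxmin_alg) (I : seq R) : option config :=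
  let J := sort (fun x y => y <= x) I in run k B A (size J) [::] J.

Definition bounded_kcc_alg (k B : nat) (A : maxmin_alg) : Prop :=
  forall I : seq R, items_ok I -> run_alg k B A I <> None.

Definition alg_cost (k B : nat) (A : maxmin_alg) (I : seq R) : nat :=
  match run_alg k B A I with Some c => size c | None => 0%N end.

End BinPacking.

(* Main.v *)
Require Import Defs.
From HB Require Import structures.
From mathcomp Require Import all_boot all_order all_algebra.
From mathcomp Require Import zify ring lra.
Set Implicit Arguments. Unset Strict Implicit. Unset Printing Implicit Defensive.
Import Order.TTheory GRing.Theory Num.Theory.
Local Open Scope ring_scope.

(** One sorted instance defeats every algorithm: [m] big items slightly above
    1/2, [m] medium ones slightly above 1/3, [m] small ones slightly above 1/7
    and [(k - 3) m] tiny ones, so that one of each of the first three kinds and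
    [k - 3] tiny items fill a bin.  As long as big items and non-medium tails
    both remain, no medium item can be taken.
    - If the big items run out first, only bins open at that moment can hold
      both a big and a medium item; giving weight 1 to big and 1/2 to medium
      items, closed bins have weight at most 1 and the total weight is 3m/2.
    - Otherwise the tiny items run out, and then the small ones.  Give weight
      1/2 to big and medium, 1/6 to small and 1/(2(k - 1)) to tiny items, for a
      total of (5/3 - 1/(k - 1)) m.  A bin of weight above 1 mixes kinds
      packed in different phases, so it was open at one of the two phase
      changes. *)

(** * Configurations along a run *)

Definition empty_bin (R : realFieldType) : bin R := ([::], false).

(* From [c] to [c'] only items satisfying [P] are packed; bins closed in [c] are
   left unchanged.  Out-of-range indices denote [empty_bin], which makes bins
   opened after [c] a special case. *)
Definition extends {R : realFieldType} (P : pred R) (c c' : config R) : Prop :=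
  (size c <= size c')%N /\
  forall j, exists u,
    [/\ (nth (empty_bin R) c' j).1 = (nth (empty_bin R) c j).1 ++ u, all P u &
        (j < size c)%N -> ~~ (nth (empty_bin R) c j).2 ->
        nth (empty_bin R) c' j = nth (empty_bin R) c j].

Definition load {R : realFieldType} (w : R -> R) (c : config R) : R :=
  \sum_(b <- c) \sum_(x <- b.1) w x.

Definition valid_bin {R : realFieldType} (k : nat) (b : bin R) : bool :=
  (\sum_(x <- b.1) x <= 1) && (size b.1 <= k)%N.

Lemma nth_close_bins (R : realFieldType) cs (c : config R) j :
  nth (empty_bin R) (close_bins cs c) j
  = ((nth (empty_bin R) c j).1, (nth (empty_bin R) c j).2 && (j \notin cs)).
Proof.
rewrite /close_bins; have [lt_jc|le_cj] := ltnP j (size c).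
  by rewrite nth_mkseq.
by rewrite !nth_default ?size_mkseq.
Qed.

Lemma load_close_bins (R : realFieldType) w cs (c : config R) :
  load w (close_bins cs c) = load w c.
Proof.
rewrite /load /close_bins /mkseq big_map [RHS](big_nth (empty_bin R)).
by rewrite /index_iota subn0.
Qed.

Lemma extends_refl (R : realFieldType) (P : pred R) c : extends P c c.
Proof. by split=> // j; exists [::]; rewrite cats0. Qed.

Lemma extends_trans (R : realFieldType) (P : pred R) c1 c2 c3 :
  extends P c1 c2 -> extends P c2 c3 -> extends P c1 c3.
Proof.
move=> [s12 e12] [s23 e23]; split; first exact: leq_trans s23.
move=> j; have [u [Eu Pu cu]] := e12 j; have [v [Ev Pv cv]] := e23 j.
exists (u ++ v); split; rewrite ?all_cat ?Pu //; first by rewrite catA -Eu.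
move=> lt_j cl; rewrite -(cu lt_j cl) cv ?(cu lt_j cl) //.
exact: leq_trans s12.
Qed.

Lemma extends_sub (R : realFieldType) (P Q : pred R) c c' :
  {subset P <= Q} -> extends P c c' -> extends Q c c'.
Proof.
move=> sPQ [s e]; split=> // j; have [u [Eu Pu cu]] := e j; exists u; split=> //.
by apply: sub_all Pu => x; apply: sPQ.
Qed.

Lemma place_extends (R : realFieldType) (P : pred R) k x tgt cs c c' :
  place k x tgt (close_bins cs c) = Some c' -> P x -> extends P c c'.
Proof.
have szc : size (close_bins cs c) = size c by rewrite size_mkseq.
move=> + Px; case: tgt => [i|] /=.
  case: ifP => // /and4P[lt_ic op _ _] [<-].
  rewrite szc in lt_ic; split.
    by rewrite size_set_nth szc leq_maxr.
  rewrite -[([::], false)]/(empty_bin R) nth_close_bins in op *.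
  move=> j; rewrite nth_set_nth /=; case: eqVneq => [->|_].
    (* [place] accepts open bins only, so the clause on closed bins is vacuous. *)
    exists [:: x]; rewrite cats1 /= Px; split=> // _.
    by move: op => /=; case: (nth _ c i).2.
  exists [::]; rewrite nth_close_bins cats0; split=> // _ /negbTE cl.
  by rewrite cl; case: (nth _ c j) cl => ? ? /= ->.
move=> [<-]; split; first by rewrite size_rcons szc.
move=> j; rewrite nth_rcons szc nth_close_bins.
case: ltngtP => [lt_jc|gt_jc|->].
- exists [::]; rewrite cats0; split=> // _ /negbTE cl.
  by rewrite cl; case: (nth _ c j) cl => ? ? /= ->.
- by exists [::]; rewrite nth_default // ltnW.
- by exists [:: x]; rewrite nth_default //= Px.
Qed.

Lemma place_load (R : realFieldType) w k x tgt cs (c c' : config R) :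
  place k x tgt (close_bins cs c) = Some c' -> load w c' = load w c + w x.
Proof.
rewrite -(load_close_bins w cs c); move: (close_bins cs c) => {}c.
case: tgt => [i|] /=.
  case: ifP => // /and4P[lt_ic _ _ _] [<-].
  rewrite /load set_nthE lt_ic -[in RHS](cat_take_drop i c) (drop_nth (empty_bin R) lt_ic).
  by rewrite !big_cat !big_cons /= big_rcons /=; ring.
by move=> [<-]; rewrite /load big_rcons /= big_seq1 addrC.
Qed.

Lemma place_valid (R : realFieldType) k x tgt cs (c c' : config R) :
  (0 < k)%N -> x <= 1 ->
  place k x tgt (close_bins cs c) = Some c' ->
  all (valid_bin k) c -> all (valid_bin k) c'.
Proof.
move=> k_gt0 x_le1 pl vc.
have {}vc : all (valid_bin k) (close_bins cs c).
  apply/(all_nthP (empty_bin R)) => j; rewrite size_mkseq nth_close_bins => lt_j.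
  by have := all_nthP (empty_bin R) vc j lt_j; rewrite /valid_bin.
move: (close_bins cs c) pl vc => {}c; case: tgt => [i|] /=.
  case: ifP => // /and4P[lt_ic _ sx szx] [<-] vc.
  rewrite set_nthE lt_ic all_cat /=.
  move: vc; rewrite -{1}(cat_take_drop i.+1 c) (take_nth (empty_bin R)) //.
  rewrite all_cat all_rcons -andbA => /and3P[_ -> ->] /=; rewrite andbT.
  by rewrite /valid_bin /= big_rcons /= sx size_rcons.
by move=> [<-] vc; rewrite all_rcons vc /valid_bin /= big_seq1 x_le1 k_gt0.
Qed.

(** The decision rule of [A] is forgotten here: later arguments use only that each step packs the
    head or the tail and respects the space bound. *)
Lemma run_cons (R : realFieldType) k B (A : maxmin_alg R) n c h s cf :
  run k B A n.+1 c (h :: s) = Some cf ->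
  exists x rem' c' tgt cs,
    [/\ (x, rem') = (h, s) \/ (x, rem') = (last h s, belast h s),
        place k x tgt (close_bins cs c) = Some c', (n_open c' <= B)%N &
        run k B A n c' rem' = Some cf].
Proof.
move=> /=; set d := A c h _; case pl : place => [c'|//]; case: ifP => // op rn.
exists (if dhead d then h else last h s), (if dhead d then s else belast h s), c'.
exists (dtarget d), (dclose d); split=> //.
by case: (dhead d); [left | right].
Qed.

Lemma run_all (R : realFieldType) k B (A : maxmin_alg R) (P : pred R) n c rem cf :
  (0 < k)%N -> size rem = n -> all P rem -> {in P, forall x, x <= 1} ->
  run k B A n c rem = Some cf ->
  [/\ extends P c cf,
      all (valid_bin k) c -> all (valid_bin k) cf &
      forall w, load w cf = load w c + \sum_(x <- rem) w x].
Proof.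
move=> k_gt0; elim: n c rem => [|n IH] c [|h s] //=.
  move=> _ _ _ [<-]; split=> // [|w]; first exact: extends_refl.
  by rewrite big_nil addr0.
move=> [sz] Phs P1; rewrite -[in Some cf]/(Some cf) => rn.
have [x [rem' [c' [tgt [cs [Ex pl _ rn']]]]]] := run_cons (n := n) (h := h) (s := s) rn.
have pm : perm_eq (h :: s) (x :: rem').
  by case: Ex => -[-> ->] //; rewrite lastI perm_rcons.
have /andP[Px Pr] : all P (x :: rem') by rewrite -(perm_all _ pm).
have sz' : size rem' = n by have := perm_size pm; rewrite /= sz => -[].
have [e v l] := IH _ _ sz' Pr P1 rn'; split.
- exact: extends_trans (place_extends pl Px) e.
- by move=> vc; apply/v/(place_valid k_gt0 (P1 _ Px) pl).
- by move=> w; rewrite l (place_load _ pl) (perm_big _ pm) big_cons addrA.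
Qed.

(** While copies of both [x] and [y] remain, they are the head and the tail, so [L] stays untouched
    and each step lowers [a + d]. The configuration [c'] is the phase change at which open bins are
    counted. *)
Lemma run_phase (R : realFieldType) k B (A : maxmin_alg R) x y L a d c cf :
  let rem a d := nseq a x ++ L ++ nseq d y in
  run k B A (size (rem a d)) c (rem a d) = Some cf -> (n_open c <= B)%N ->
  exists c' a' d',
    [/\ (a' == 0%N) || (d' == 0%N), extends (mem [:: x; y]) c c', (n_open c' <= B)%N &
        run k B A (size (rem a' d')) c' (rem a' d') = Some cf].
Proof.
move=> rem; have [n le_n] := ubnP (a + d).
elim: n a d c le_n => // n IH a d c le_n rn op.
have [az|a_gt0] := posnP a.
  by exists c, a, d; rewrite [in a == _]az; split=> //; apply: extends_refl.
have [dz|d_gt0] := posnP d.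
  by exists c, a, d; rewrite [in d == _]dz orbT; split=> //; apply: extends_refl.
case: a d a_gt0 d_gt0 le_n rn => [|a] [|d] // _ _ le_n rn.
have [z [rem' [c' [tgt [cs [Ez pl op' rn']]]]]] :=
  run_cons (h := x) (s := nseq a x ++ L ++ nseq d.+1 y) rn.
have lastE : y :: nseq d y = rcons (nseq d y) y.
  by rewrite -[LHS]/(nseq d.+1 y) -addn1 nseqD cats1.
have [a' [d' [lt_ad remE zxy]]] : exists a' d',
    [/\ (a' + d' < n)%N, rem' = rem a' d' & z \in [:: x; y]].
  case: Ez => -[-> ->].
    by exists a, d.+1; rewrite mem_head; split=> //; lia.
  exists a.+1, d; rewrite lastE -!rcons_cat last_rcons belast_rcons !inE eqxx orbT.
  by split=> //; lia.
have szE : size (rem a' d') = size (nseq a x ++ L ++ nseq d.+1 y).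
  rewrite -remE; case: Ez => -[_ ->] //; exact: size_belast.
have {}rn' : run k B A (size (rem a' d')) c' (rem a' d') = Some cf.
  by rewrite szE -remE.
have [c2 [a2 [d2 [z2 e2 op2 rn2]]]] := IH _ _ _ lt_ad rn' op'.
exists c2, a2, d2; split=> //.
exact: extends_trans (place_extends pl zxy) e2.
Qed.

(** * Two tools for the optimum: block packings and a counting bound *)

(** Residue [j] modulo [m] selects exactly one item of each block. [F] is generic so that both the
    size and the cardinality of a bin can be computed. *)
Lemma sum_blocks (T : Type) (V : nmodType) (F : T -> V) x0 m vs j :
  (j < m)%N ->
  let s := flatten [seq nseq m v | v <- vs] in
  \sum_(i < size s | (i %% m == j)%N) F (nth x0 s i) = \sum_(v <- vs) F v.
Proof.
move=> lt_jm; elim: vs => [|v vs IH] /=; first by rewrite big_ord0 big_nil.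
set s := flatten _ in IH *.
rewrite big_cons -IH -(big_mkord (fun i => i %% m == j)%N (fun i => F (nth x0 (_ ++ s) i))).
(* In the first block only index [j] survives; shifting the rest by [m] keeps residues and leads to
   the induction hypothesis. *)
rewrite size_cat size_nseq (big_cat_nat (n := m)) //= ?leq_addr //.
congr (_ + _).
  rewrite big_mkord (bigD1 (Ordinal lt_jm)) /= ?modn_small //.
  rewrite nth_cat size_nseq lt_jm nth_nseq lt_jm big1 ?addr0 // => i /andP[].
  by rewrite modn_small // -val_eqE => ->.
rewrite -{1}[m]addn0 addnC big_addn addKn big_mkord.
apply: eq_big => [i|i _]; first by rewrite modnDr.
by rewrite nth_cat size_nseq ltnNge leq_addl addnK.
Qed.

Lemma feasible_blocks (R : realFieldType) k m (vs : seq R) :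
  (0 < m)%N -> \sum_(v <- vs) v <= 1 -> (size vs <= k)%N ->
  feasible_k k (flatten [seq nseq m v | v <- vs]) m.
Proof.
move=> m_gt0 vs1 szk; exists (fun i => (i %% m)%N); split=> [i|j lt_jm].
  by rewrite ltn_mod.
split; first by rewrite (sum_blocks id).
rewrite -sum1_card; under eq_bigl do rewrite inE.
by rewrite (sum_blocks (V := nat) (fun=> 1%N) 0) // [X in (X <= k)%N]sum1_size.
Qed.

(** Three items above 1/3 overflow a bin, so each bin holds at most two. *)
Lemma feasible_count (R : realFieldType) k (I : seq R) b (d : R) :
  all (>= 0) I -> 3^-1 < d -> feasible_k k I b -> (count (>= d) I <= 2 * b)%N.
Proof.
move=> I0 d3 [f [fb fP]].
rewrite -sum1_count (big_nth 0) big_mkord.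
rewrite (partition_big (fun i => Ordinal (fb i)) xpredT) //=.
have -> : (2 * b = \sum_(j < b) 2)%N by rewrite sum_nat_const card_ord mulnC.
apply: leq_sum => j _; rewrite sum1_card leqNgt; apply/negP.
set P := (X in #|X|) => P3; have [le1 _] := fP j (ltn_ord j).
have: \sum_(i in P) d <= 1.
  apply: le_trans le1; rewrite big_mkcond [leRHS]big_mkcond.
  apply: ler_sum => i _; rewrite unfold_in /= -val_eqE /=.
  case: (f i == j); rewrite ?andbT ?andbF //; case: ifP => // _.
  by apply: (all_nthP 0 I0).
rewrite sumr_const -mulr_natl; have : (3 : R) <= #|P|%:R by rewrite ler_nat.
by move: #|P|%:R => n n3; nra.
Qed.

(** * The hard instance and its optimum *)

(* 106 + 71 + 31 = 208, which leaves room for [k - 3] tiny items. *)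
Definition big_item (R : realFieldType) : R := 106 / 210.
Definition medium_item (R : realFieldType) : R := 71 / 210.
Definition small_item (R : realFieldType) : R := 31 / 210.
Definition tiny_item (R : realFieldType) (k : nat) : R := (210 * k%:R)^-1.

Definition hard_instance (R : realFieldType) (k m : nat) : seq R :=
  nseq m (big_item R) ++ (nseq m (medium_item R) ++ nseq m (small_item R)) ++
  nseq ((k - 3) * m) (tiny_item R k).

Lemma tiny_item_bounds (R : realFieldType) k :
  (3 < k)%N -> 0 < tiny_item R k /\ tiny_item R k < small_item R.
Proof.
move=> k3; have k4 : (4 : R) <= k%:R by rewrite ler_nat.
rewrite /tiny_item /small_item; split; first by rewrite invr_gt0; lra.
by rewrite invf_plt ?posrE; lra.
Qed.

Lemma hard_instance_mem (R : realFieldType) k m :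
  {subset hard_instance R k m <=
     [:: big_item R; medium_item R; small_item R; tiny_item R k]}.
Proof.
move=> x; rewrite /hard_instance !mem_cat !mem_nseq !inE.
by do ![case: eqP => //= _]; rewrite ?orbT ?andbF.
Qed.

Lemma hard_instance_ok (R : realFieldType) k m :
  (3 < k)%N -> items_ok (hard_instance R k m).
Proof.
move=> k3; have [t0 ts] := tiny_item_bounds R k3.
apply/allP => x /hard_instance_mem; rewrite !inE.
case/or4P => /eqP->; move: t0 ts; rewrite /big_item /medium_item /small_item => *;
  by apply/andP; split; lra.
Qed.

Lemma hard_instance_sorted (R : realFieldType) k m :
  (3 < k)%N -> sorted_items (hard_instance R k m).
Proof.
move=> k3; have [_ ts] := tiny_item_bounds R k3.
rewrite /sorted_items sorted_pairwise; last by move=> x y z yx zy; apply: le_trans yx.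
have pw n (x : R) : pairwise (fun x y : R => y <= x) (nseq n x).
  by elim: n => //= n ->; rewrite all_nseq lexx orbT.
have ar n p (x y : R) : y <= x -> allrel (fun x y : R => y <= x) (nseq n x) (nseq p y).
  by move=> yx; rewrite /allrel all_nseq /= all_nseq yx !orbT.
rewrite !pairwise_cat !pw !allrel_catr !allrel_catl !ar //;
  move: ts; rewrite /big_item /medium_item /small_item; lra.
Qed.

(** Minimality: the [2 * m] big and medium items all exceed 1/3. The packing with [m] bins is the
    block packing. *)
Lemma hard_instance_opt (R : realFieldType) k m :
  (3 < k)%N -> (0 < m)%N -> opt_k k (hard_instance R k m) m.
Proof.
move=> k3 m0; have k4 : (4 : R) <= k%:R by rewrite ler_nat.
split; last first=> [b fb|].
  have I0 : all (>= 0) (hard_instance R k m).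
    by apply/allP => x /(allP (hard_instance_ok R m k3)) /andP[/ltW].
  have d3 : 3^-1 < medium_item R by rewrite /medium_item; lra.
  have mb : medium_item R <= big_item R by rewrite /medium_item /big_item; lra.
  have := feasible_count I0 d3 fb.
  rewrite /hard_instance !count_cat !count_nseq /= mb lexx !mul1n.
  by move: (_ * m)%N (_ * (_ * m))%N => p q; lia.
pose vs := [:: big_item R, medium_item R, small_item R & nseq (k - 3) (tiny_item R k)].
have -> : hard_instance R k m = flatten [seq nseq m v | v <- vs].
  rewrite /hard_instance /= -catA; do 3!congr (_ ++ _).
  by elim: (k - 3)%N => //= n <-; rewrite mulSn nseqD.
apply: feasible_blocks => //; last by rewrite /= size_nseq; lia.
rewrite !big_cons big_nseq iter_addr_0 -mulr_natl natrB 1?ltnW //.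
(* The tiny items of one bin have total size [(k - 3) / (210 k)], within the 2/210 left over. *)
have : (k%:R - 3) * tiny_item R k <= 210^-1.
  rewrite /tiny_item ler_pdivrMr; last lra.
  by rewrite mulrA mulVf ?mul1r; lra.
rewrite /big_item /medium_item /small_item; lra.
Qed.

(** * Item counts, open bins and weights *)

Lemma sum_count_mem (T : eqType) (V : nmodType) (F : T -> V) (s l : seq T) :
  uniq s -> {subset l <= s} ->
  \sum_(x <- l) F x = \sum_(y <- s) F y *+ count_mem y l.
Proof.
move=> us sub.
transitivity (\sum_(x <- l) \sum_(y <- s | y == x) F y).
  by apply: eq_big_seq => x /sub xs; rewrite -big_filter filter_pred1_uniq ?big_seq1.
rewrite (exchange_big_dep xpredT) //=; apply: eq_bigr => y _.
by rewrite big_const_seq iter_addr_0; congr (_ *+ _); apply: eq_count => x; rewrite eq_sym.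
Qed.

Lemma extends_count (R : realFieldType) (P : pred R) c c' j x :
  extends P c c' -> ~~ P x ->
  count_mem x (nth (empty_bin R) c' j).1 = count_mem x (nth (empty_bin R) c j).1.
Proof.
move=> [_ /(_ j) [u [-> Pu _]]] nPx; rewrite count_cat.
suff /count_memPn -> : x \notin u by rewrite addn0.
by apply: contra nPx => /(allP Pu).
Qed.

(** There are two ways not to be open: a bin closed in [c] keeps its items for good, and an index
    not yet used in [c] reads as the empty bin. *)
Lemma extends_closed (R : realFieldType) (P : pred R) c c' j :
  extends P c c' -> ~~ (nth (empty_bin R) c j).2 ->
  (nth (empty_bin R) c' j).1 = (nth (empty_bin R) c j).1 \/ (nth (empty_bin R) c j).1 = [::].
Proof.
move=> [_ /(_ j) [u [_ _ cu]]] cl; have [lt_j|le_j] := ltnP j (size c).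
  by left; rewrite cu.
by right; rewrite nth_default.
Qed.

Lemma sum_open (R : realFieldType) (c : config R) n :
  (size c <= n)%N -> (\sum_(j < n) (nth (empty_bin R) c j).2 = n_open c)%N.
Proof.
(* Indices past the end of [c] read as the default bin, which is not open and adds nothing. *)
move=> /subnKC <-; rewrite big_split_ord /= [X in (_ + X)%N]big1 ?addn0 => [|j _].
  rewrite /n_open -sum1_count [RHS]big_mkcond [RHS](big_nth (empty_bin R)) [RHS]big_mkord.
  by apply: eq_bigr => j _; case: (nth _ c j).2.
by rewrite nth_default ?leq_addr.
Qed.

(** [e1] and [e2] are the excess over 1 charged to a bin open at [c1] and at [c2]; each charge is
    made at most [B] times. *)
Lemma load_le_size (R : realFieldType) (w : R -> R) cf c1 c2 B e1 e2 :
  0 <= e1 -> 0 <= e2 -> (n_open c1 <= B)%N -> (n_open c2 <= B)%N ->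
  (size c1 <= size cf)%N -> (size c2 <= size cf)%N ->
  (forall j, (j < size cf)%N ->
     \sum_(x <- (nth (empty_bin R) cf j).1) w x <=
     1 + e1 * (nth (empty_bin R) c1 j).2%:R + e2 * (nth (empty_bin R) c2 j).2%:R) ->
  load w cf <= (size cf)%:R + (e1 + e2) * B%:R.
Proof.
move=> e1_ge0 e2_ge0 o1 o2 s1 s2 le_w.
rewrite /load (big_nth (empty_bin R)) big_mkord.
apply: le_trans (ler_sum _ (fun (j : 'I_(size cf)) _ => le_w j (ltn_ord j))) _.
rewrite !big_split /= sumr_const card_ord -!mulr_sumr -!natr_sum !sum_open //.
rewrite -addrA lerD2l mulrDl lerD // ler_wpM2l // ler_nat //.
Qed.

Definition item_kinds (R : realFieldType) (k : nat) : seq R :=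
  [:: big_item R; medium_item R; small_item R; tiny_item R k].

Definition item_weight (R : realFieldType) (p q r t x : R) : R :=
  if x == big_item R then p else if x == medium_item R then q
  else if x == small_item R then r else t.

Lemma item_kinds_lt (R : realFieldType) k :
  (3 < k)%N ->
  [/\ small_item R < medium_item R, medium_item R < big_item R &
      tiny_item R k < small_item R].
Proof.
move=> /(tiny_item_bounds R) [_ ts]; split=> //.
  by rewrite /small_item /medium_item; lra.
by rewrite /big_item /medium_item; lra.
Qed.

Lemma item_kinds_uniq (R : realFieldType) k : (3 < k)%N -> uniq (item_kinds R k).
Proof.
move=> /(item_kinds_lt R) [sm mb ts].
have tm := lt_trans ts sm; have sb := lt_trans sm mb; have tb := lt_trans tm mb.
by rewrite /= !inE !gt_eqF.
Qed.

Lemma item_weightE (R : realFieldType) k (p q r t : R) :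
  (3 < k)%N ->
  [/\ item_weight p q r t (big_item R) = p, item_weight p q r t (medium_item R) = q,
      item_weight p q r t (small_item R) = r & item_weight p q r t (tiny_item R k) = t].
Proof.
move=> /(item_kinds_lt R) [sm mb ts].
have tm := lt_trans ts sm; have sb := lt_trans sm mb; have tb := lt_trans tm mb.
by rewrite /item_weight !eqxx !lt_eqF.
Qed.

Lemma sum_item_weight (R : realFieldType) k (p q r t : R) (l : seq R) :
  (3 < k)%N -> {subset l <= item_kinds R k} ->
  \sum_(x <- l) item_weight p q r t x =
  p * (count_mem (big_item R) l)%:R + q * (count_mem (medium_item R) l)%:R +
  r * (count_mem (small_item R) l)%:R + t * (count_mem (tiny_item R k) l)%:R.
Proof.
move=> k3 sub; have [eb em es et] := item_weightE p q r t k3.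
rewrite (sum_count_mem _ (item_kinds_uniq R k3) sub) /item_kinds !big_cons big_nil.
by rewrite eb em es et !mulr_natr addr0 !addrA.
Qed.

(** Scaling by 210 makes the capacity an integer constraint on the three larger kinds; tiny items
    are kept only in the cardinality constraint. *)
Lemma valid_bin_counts (R : realFieldType) k (b : bin R) :
  (3 < k)%N -> {subset b.1 <= item_kinds R k} -> valid_bin k b ->
  let n x := count_mem x b.1 in
  (106 * n (big_item R) + 71 * n (medium_item R) + 31 * n (small_item R) <= 210)%N /\
  (n (big_item R) + n (medium_item R) + n (small_item R) + n (tiny_item R k) <= k)%N.
Proof.
move=> k3 sub /andP[le1 szk] n.
have [t0 _] := tiny_item_bounds R k3.
have us := item_kinds_uniq R k3.
split.
  move: le1; rewrite (sum_count_mem id us sub).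
  under eq_bigr => y _ do rewrite -mulr_natr.
  rewrite !big_cons big_nil -!/(n _) /big_item /medium_item /small_item.
  have : 0 <= tiny_item R k * (n (tiny_item R k))%:R by rewrite mulr_ge0 ?ler0n ?ltW.
  move: (n _) (n _) (n _) (tiny_item R k * _) => z y x u u0 le1.
  rewrite -(ler_nat R) (natrD _ (106 * x + 71 * y)%N) (natrD _ (106 * x)%N) !natrM.
  by clear - le1 u0; lra.
move: szk; rewrite -[size _]sum1_size.
rewrite (sum_count_mem (V := nat) (fun=> 1%N) us sub) !big_cons big_nil.
have nat1 q : (1%N *+ q)%R = q by elim: q => // q IH; rewrite mulrS IH.
by rewrite !nat1 /n /= /GRing.add /=; lia.
Qed.

Lemma sum_hard_instance (R : realFieldType) k m (p q r t : R) :
  (3 < k)%N ->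
  \sum_(x <- hard_instance R k m) item_weight p q r t x =
  (p + q + r + t * (k%:R - 3)) * m%:R.
Proof.
move=> k3; have [eb em es et] := item_weightE p q r t k3.
rewrite /hard_instance !big_cat !big_nseq !iter_addr_0 eb em es et.
rewrite -(mulr_natr p) -(mulr_natr q) -(mulr_natr r) -(mulr_natr t) natrM natrB 1?ltnW //.
by rewrite /=; ring.
Qed.

(** With weights 1/2, 1/2 and 1/6, the non-tiny items weigh [(3 * (h + m) + s) / 6]: at most 4/3,
    and at most 1 without medium items. *)
Lemma item_count_bounds h m s :
  (106 * h + 71 * m + 31 * s <= 210)%N ->
  [/\ h <= 1, h + m <= 2, 3 * (h + m) + s <= 8 & m = 0 -> 3 * h + s <= 6]%N.
Proof. by move=> ?; split; lia. Qed.

(* [o1] and [o2] say whether the bin was open when the tiny, respectively the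
   small, items ran out. *)
Lemma mixed_bin_weight (R : realFieldType) (k h m s a : nat) (o1 o2 : bool) (t : R) :
  (3 < k)%N -> t = (2 * (k - 1)%:R)^-1 ->
  (106 * h + 71 * m + 31 * s <= 210)%N -> (h + m + s + a <= k)%N ->
  (~~ o1 -> a = 0 \/ m = 0 /\ s = 0)%N ->
  (~~ o2 -> m = 0 \/ a = 0 /\ s = 0)%N ->
  2^-1 * h%:R + 2^-1 * m%:R + 6^-1 * s%:R + t * a%:R <=
  1 + (2^-1 - 3 * t) * o1%:R + 3^-1 * o2%:R.
Proof.
move=> k3 tE /item_count_bounds[h1 hm2 hms8 hs6] card_le closed1 closed2.
have {h1}h1 : h%:R <= 1 :> R by rewrite (ler_nat _ _ 1).
have {hm2}hm2 : h%:R + m%:R <= 2 :> R by rewrite -natrD ler_nat.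
have {hms8}hms8 : 3 * (h%:R + m%:R) + s%:R <= 8 :> R.
  by rewrite -natrD -natrM -natrD ler_nat.
have {hs6}hs6 : m = 0%N -> 3 * h%:R + s%:R <= 6 :> R.
  by move=> /hs6; rewrite -(ler_nat R) natrD natrM.
have k4 : (4 : R) <= k%:R by rewrite ler_nat.
(* The weight [t] makes one big and [k - 1] tiny items weigh exactly 1. *)
have kE : t * (k%:R - 1) = 2^-1.
  by rewrite tE natrB 1?ltnW 1?ltnW 1?ltnW //; field; lra.
have t_gt0 : 0 < t by rewrite tE invr_gt0 mulr_gt0 // ltr0n subn_gt0 ltnW // ltnW.
have t_le6 : t <= 6^-1 by clear - kE k4 t_gt0; nra.
have ta_le : t * a%:R <= 2^-1 + t * (1 - h%:R - m%:R - s%:R).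
  rewrite -kE -mulrDr ler_pM2l //.
  by move: card_le; rewrite -(ler_nat R) !natrD; clear; lra.
have a0 : a = 0%N -> t * a%:R = 0 by move=> ->; rewrite mulr0.
have p1 : 0 <= (1 - h%:R) * (2^-1 - t) by apply: mulr_ge0; clear - h1 t_le6; lra.
have p2 : 0 <= (1 - h%:R) * t by apply: mulr_ge0; clear - h1 t_gt0; lra.
have p3 : 0 <= (2 - (h%:R + m%:R)) * t by apply: mulr_ge0; clear - hm2 t_gt0; lra.
have p4 : 0 <= (8 - (3 * (h%:R + m%:R) + s%:R)) * (6^-1 - t).
  by apply: mulr_ge0; clear - hms8 t_le6; lra.
have p5 : m = 0%N -> 0 <= (6 - (3 * h%:R + s%:R)) * (6^-1 - t).
  by move=> /hs6 {}hs6; apply: mulr_ge0; clear - hs6 t_le6; lra.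
move: (t * a%:R) ta_le a0 => z ta_le a0.
case: o1 closed1 => [_|/(_ isT) c1]; case: o2 closed2 => [_|/(_ isT) c2] /=;
  clear k3 tE k4 kE card_le.
(* The charges come from extreme bins: two medium, two small and [k - 4] tiny items attain both; one
   big, three small and [k - 4] tiny items attain the first alone; two medium and two small items
   the second alone. *)
- by clear - ta_le p3 p4; lra.
- case: c2 => [m0|[/a0 -> ->]]; last by clear - hm2 t_le6; lra.
  move: (p5 m0) ta_le; rewrite m0; clear - p2; lra.
- case: c1 => [/a0 ->|[m0 s0]]; first by clear - hms8; lra.
  by move: ta_le; rewrite m0 s0; clear - p1; lra.
- case: c1 => [/a0 ->|[m0 s0]]; last by move: ta_le; rewrite m0 s0; clear - p1; lra.
  case: c2 => [m0|[_ ->]]; last by clear - hm2; lra.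
  by move: (hs6 m0); rewrite m0; clear; lra.
Qed.

(** * Total weight against the number of bins, in the two outcomes *)

Lemma extends_nil_sub (R : realFieldType) (s : seq R) c :
  extends (mem s) [::] c -> forall j, {subset (nth (empty_bin R) c j).1 <= s}.
Proof.
by move=> [_ e] j; have [u [-> /allP Pu _]] := e j; rewrite nth_nil.
Qed.

Lemma bins_counts (R : realFieldType) k (cf : config R) :
  (3 < k)%N -> extends (mem (item_kinds R k)) [::] cf -> all (valid_bin k) cf ->
  forall j, (j < size cf)%N ->
  let n x := count_mem x (nth (empty_bin R) cf j).1 in
  (106 * n (big_item R) + 71 * n (medium_item R) + 31 * n (small_item R) <= 210)%N /\
  (n (big_item R) + n (medium_item R) + n (small_item R) + n (tiny_item R k) <= k)%N.
Proof.
move=> k3 ecf vcf j lt_j; apply: valid_bin_counts => //.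
  exact: extends_nil_sub.
exact: (all_nthP (empty_bin R) vcf).
Qed.

(** Big items run out at [c]: no medium item is packed before it and no big one after. A bin open at
    [c] holds at most one big item, and at most two big or medium ones, hence weighs at most 3/2. *)
Lemma load_big_exhausted (R : realFieldType) k B (c cf : config R) :
  let H := big_item R in let M := medium_item R in let S := small_item R in
  let e := tiny_item R k in
  (3 < k)%N -> all (valid_bin k) cf -> (n_open c <= B)%N ->
  extends (mem [:: H; S; e]) [::] c -> extends (mem [:: M; S; e]) c cf ->
  load (item_weight 1 2^-1 0 0) cf <= (size cf)%:R + 2^-1 * B%:R.
Proof.
move=> H M S e k3 vcf op ec ecf.
have ecf0 : extends (mem (item_kinds R k)) [::] cf.
  apply: (extends_trans (c2 := c)).
    by apply: extends_sub ec => x; rewrite !inE => /or3P[]->; rewrite ?orbT.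
  by apply: extends_sub ecf => x; rewrite !inE => /or3P[]->; rewrite ?orbT.
have := item_kinds_uniq R k3; rewrite /= !inE !negb_or andbT.
move=> /and3P[/and3P[HM HS He] /andP[MS Me] Se].
have [szc _] := ecf.
(* A single phase change matters here, so [c] serves twice, the second time with charge 0. *)
rewrite -[2^-1 in leRHS]addr0.
apply: (load_le_size (e1 := 2^-1) (e2 := 0) _ _ op op) => // [|j lt_j].
  by rewrite invr_ge0 ler0n.
rewrite (sum_item_weight _ _ _ _ k3 (extends_nil_sub ecf0 (j := j))).
have [sz _] := bins_counts k3 ecf0 vcf lt_j; move: sz => /=.
have hE := extends_count j (x := H) ecf.
have mE := extends_count j (x := M) ec.
rewrite !inE in hE mE; rewrite !mul0r !addr0 mul1r.
have closed : ~~ (nth (empty_bin R) c j).2 ->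
    count_mem H (nth (empty_bin R) cf j).1 = 0%N \/
    count_mem M (nth (empty_bin R) cf j).1 = 0%N.
  move=> cl; case: (extends_closed ecf cl) => Ecf; [right|left].
    by rewrite Ecf mE ?nth_nil // !negb_or eq_sym HM MS Me.
  by rewrite hE ?Ecf // !negb_or HM HS He.
move: closed; rewrite -/H -/M.
move: (count _ _) (count _ _) (count _ _) (nth _ c j).2 => s m h o closed sz.
have [h1 hm _ _] := item_count_bounds sz.
have {h1}h1 : h%:R <= 1 :> R by rewrite (ler_nat _ _ 1).
have {hm}hm : h%:R + m%:R <= 2 :> R by rewrite -natrD ler_nat.
have h0 : 0 <= h%:R :> R by rewrite ler0n.
case: o closed => [_|/(_ isT) hm0] /=; first by clear - h1 hm; lra.
by case: hm0 hm h1 h0 => -> /=; clear; lra.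
Qed.

(** Tiny items run out at [c1] and small ones at [c2]; big items may be packed throughout. *)
Lemma load_small_exhausted (R : realFieldType) k B (c1 c2 cf : config R) :
  let H := big_item R in let M := medium_item R in let S := small_item R in
  let e := tiny_item R k in
  let t := (2 * (k - 1)%:R)^-1 in
  (3 < k)%N -> all (valid_bin k) cf -> (n_open c1 <= B)%N -> (n_open c2 <= B)%N ->
  extends (mem [:: H; e]) [::] c1 -> extends (mem [:: H; S]) c1 c2 ->
  extends (mem [:: H; M]) c2 cf ->
  load (item_weight 2^-1 2^-1 6^-1 t) cf <=
  (size cf)%:R + (2^-1 - 3 * t + 3^-1) * B%:R.
Proof.
move=> H M S e t k3 vcf op1 op2 ec1 ec2 ecf.
have ec1f : extends (mem [:: H; M; S]) c1 cf.
  apply: (extends_trans (c2 := c2)).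
    by apply: extends_sub ec2 => x; rewrite !inE => /orP[]->; rewrite ?orbT.
  by apply: extends_sub ecf => x; rewrite !inE => /orP[]->; rewrite ?orbT.
have ecf0 : extends (mem (item_kinds R k)) [::] cf.
  apply: (extends_trans (c2 := c1)).
    by apply: extends_sub ec1 => x; rewrite !inE => /orP[]->; rewrite ?orbT.
  by apply: extends_sub ec1f => x; rewrite !inE => /or3P[]->; rewrite ?orbT.
have ec20 : extends (mem [:: H; S; e]) [::] c2.
  apply: (extends_trans (c2 := c1)).
    by apply: extends_sub ec1 => x; rewrite !inE => /orP[]->; rewrite ?orbT.
  by apply: extends_sub ec2 => x; rewrite !inE => /orP[]->; rewrite ?orbT.
have := item_kinds_uniq R k3; rewrite /= !inE !negb_or andbT.
move=> /and3P[/and3P[HM HS He] /andP[MS Me] Se].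
have k4 : (4 : R) <= k%:R by rewrite ler_nat.
have [szc2 _] := ecf; have [szc1 _] := ec1f.
apply: (load_le_size _ _ op1 op2) => // [||j lt_j].
- by rewrite subr_ge0 /t natrB 1?ltnW 1?ltnW 1?ltnW // ler_pdivrMr; lra.
- by rewrite invr_ge0 ler0n.
rewrite (sum_item_weight _ _ _ _ k3 (extends_nil_sub ecf0 (j := j))).
have [sz card] := bins_counts k3 ecf0 vcf lt_j.
apply: (mixed_bin_weight k3 _ sz card) => // cl.
- have nil1 x : x \notin [:: H; e] -> count_mem x (nth (empty_bin R) c1 j).1 = 0%N.
    by move=> nx; rewrite (extends_count j ec1) ?nth_nil.
  (* A bin closed by [c1] has only big and tiny items; one opened later gets no tiny item. *)
  case: (extends_closed ec1f cl) => E1; [right | left].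
    rewrite E1 !nil1 // !inE negb_or; first by rewrite [S == H]eq_sym HS Se.
    by rewrite [M == H]eq_sym HM Me.
  rewrite (extends_count j ec1f) ?E1 // !inE !negb_or.
  by rewrite [e == H]eq_sym He [e == M]eq_sym Me [e == S]eq_sym Se.
(* A bin closed by [c2] has no medium item; one opened later gets neither small nor tiny items. *)
- case: (extends_closed ecf cl) => E2; [left | right].
    rewrite E2 (extends_count j ec20) ?nth_nil // !inE !negb_or.
    by rewrite [M == H]eq_sym HM MS Me.
  rewrite !(extends_count j ecf) ?E2 // !inE !negb_or.
    by rewrite [S == H]eq_sym HS [S == M]eq_sym MS.
  by rewrite [e == H]eq_sym He [e == M]eq_sym Me.
Qed.

(** * The run on the hard instance and the three bounds *)

Lemma run_hard_instance (R : realFieldType) k B (A : maxmin_alg R) m cf :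
  (3 < k)%N -> run_alg k B A (hard_instance R k m) = Some cf ->
  3 / 2 * m%:R <= (size cf)%:R + 2^-1 * B%:R :> R \/
  (5 / 3 - ((k - 1)%:R)^-1) * m%:R <=
    (size cf)%:R + (5 / 6 - 3 / 2 * ((k - 1)%:R)^-1) * B%:R :> R.
Proof.
move=> k3; have k4 : (4 : R) <= k%:R by rewrite ler_nat.
have [t0 ts] := tiny_item_bounds R k3.
pose H := big_item R; pose M := medium_item R; pose S := small_item R.
pose e := tiny_item R k.
have le1 : {in item_kinds R k, forall x, x <= 1}.
  move=> x; rewrite !inE; move: ts; rewrite /big_item /medium_item /small_item.
  by move=> ts /or4P[] /eqP->; lra.
have tr : transitive (fun x y : R => y <= x) by move=> x y z yx zy; apply: le_trans yx.
rewrite /run_alg (sorted_sort tr (hard_instance_sorted R m k3)) => rn.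
have [_ /(_ isT) vcf ld] := run_all (P := mem (item_kinds R k)) (ltnW (ltnW (ltnW k3)))
  erefl (introT allP (@hard_instance_mem R k m)) le1 rn.
have {}ld w : load w cf = \sum_(x <- hard_instance R k m) w x.
  by rewrite ld /load big_nil add0r.
have finish s n c rem : {subset s <= item_kinds R k} -> {subset rem <= s} ->
    size rem = n -> run k B A n c rem = Some cf -> extends (mem s) c cf.
  move=> sk rs sz rn'; have [] // := run_all (P := mem s) (ltnW (ltnW (ltnW k3))) sz _ _ rn'.
    exact/allP.
  by move=> x /sk /le1.
have [c1 [a1 [d1 [z1 e1 op1 rn1]]]] := run_phase rn (leq0n B).
(* Big items may run out in either phase, so this is stated for any [c]. *)
have bigs c : (n_open c <= B)%N -> extends (mem [:: H; S; e]) [::] c ->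
    extends (mem [:: M; S; e]) c cf ->
    3 / 2 * m%:R <= (size cf)%:R + 2^-1 * B%:R :> R.
  move=> op ec ecf; apply: le_trans (load_big_exhausted k3 vcf op ec ecf).
  by rewrite ld (sum_hard_instance _ _ _ _ _ k3); lra.
have sub1 : {subset [:: H; e] <= [:: H; S; e]}.
  by move=> x; rewrite !inE => /orP[]->; rewrite ?orbT.
have subM : {subset [:: M; S; e] <= item_kinds R k} by move=> x xs; apply/orP; right.
case/orP: z1 => /eqP z1; subst.
  left; apply: (bigs c1) => //; first exact: extends_sub e1.
  apply: finish rn1 => // x; rewrite !mem_cat !mem_nseq !inE /=.
  by case/orP => [/orP[]|] /andP[_ ->]; rewrite ?orbT.
(* The tiny items are gone: small items now form the tail block and medium ones the untouched
   middle. *)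
rewrite cats0 in rn1.
have [c2 [a2 [d2 [z2 e2 op2 rn2]]]] := run_phase rn1 op1.
case/orP: z2 => /eqP z2; subst.
  left; apply: (bigs c2) => //.
    apply: extends_trans (extends_sub sub1 e1) _; apply: extends_sub e2 => x.
    by rewrite !inE => /orP[]->; rewrite ?orbT.
  apply: finish rn2 => // x; rewrite !mem_cat !mem_nseq !inE /=.
  by case/orP => /andP[_ ->]; rewrite ?orbT.
right; rewrite cats0 in rn2.
have e3 : extends (mem [:: H; M]) c2 cf.
  apply: finish rn2 => // x; rewrite ?mem_cat ?mem_nseq !inE.
    by case/orP=> ->; rewrite ?orbT.
  by case/orP => /andP[_ ->]; rewrite ?orbT.
have := load_small_exhausted k3 vcf op1 op2 e1 e2 e3.
rewrite ld (sum_hard_instance _ _ _ _ _ k3) natrB 1?ltnW 1?ltnW 1?ltnW //.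
set p := k%:R - 1; have p3 : 3 <= p by rewrite /p; lra.
have -> : k%:R - 3 = p - 2 :> R by rewrite /p; ring.
rewrite invfM; have : p^-1 * p = 1 by rewrite mulVf //; lra.
move: p^-1 => q qp.
(* For each unit of [m], the [k - 3] tiny items contribute weight [1/2 - q]. *)
have -> : 2^-1 * q * (p - 2) = 2^-1 * (q * p) - q by field.
rewrite qp mulr1.
have -> : 2^-1 + 2^-1 + 6^-1 + (2^-1 - q) = 5 / 3 - q by field.
by have -> : 2^-1 - 3 * (2^-1 * q) + 3^-1 = 5 / 6 - 3 / 2 * q by field.
Qed.

Theorem theorem10 (R : realFieldType) (k B : nat) (A : maxmin_alg R) (m : nat) :
  (4 <= k)%N -> (1 <= B)%N ->
  bounded_kcc_alg k B A ->
  (0 < m)%N -> ((k - 1) * B <= m)%N -> (3 %| m)%N -> ((k - 1) %| m)%N ->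
  exists I : seq R,
    [/\ items_ok I, sorted_items I, opt_k k I m &
    [/\
     ((k <= 6)%N ->
        ((alg_cost k B A I)%:R : R) >=
          (5%:R / 3%:R - ((k - 1)%:R)^-1) * m%:R - B%:R * (k%:R + 5%:R) / 6%:R),
     (k = 7%N ->
        ((alg_cost k B A I)%:R : R) >= 3%:R / 2%:R * m%:R - 2%:R * B%:R) &
     ((8 <= k)%N ->
        ((alg_cost k B A I)%:R : R) >= 3%:R / 2%:R * m%:R - B%:R / 2%:R)] ].
Proof.
move=> k4 B1 okA m0 le_m _ _; exists (hard_instance R k m).
have okI := hard_instance_ok R m k4.
split=> //; [exact: hard_instance_sorted | exact: hard_instance_opt |].
rewrite /alg_cost; case rn : run_alg (okA _ okI) => [cf|//] _.
have B0 : 0 <= B%:R :> R by rewrite ler0n.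
have m_ge0 : 0 <= m%:R :> R by rewrite ler0n.
have kR : (4 : R) <= k%:R by rewrite ler_nat.
have kE : (k - 1)%:R = k%:R - 1 :> R by rewrite natrB 1?ltnW 1?ltnW 1?ltnW.
have le_mR : (k%:R - 1) * B%:R <= m%:R :> R by rewrite -kE -natrM ler_nat.
have := run_hard_instance k4 rn; rewrite kE {rn}.
have : (k%:R - 1)^-1 * (k%:R - 1) = 1 :> R by rewrite mulVf //; lra.
move: (k%:R - 1)^-1 => q qp bound; split=> [k6|k7|k8].
- have {}k6 : k%:R <= 6 :> R by rewrite ler_nat.
  (* Then [5/3 - q <= 3/2], so the first alternative suffices as well. *)
  have q5 : 6^-1 <= q by nra.
  by case: bound; nra.
- have {}k7 : k%:R = 7 :> R by rewrite k7.
  (* Both leading constants equal 3/2 here. *)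
  have q6 : q = 6^-1 by move: qp; rewrite k7; lra.
  by case: bound; rewrite ?q6; lra.
have {}k8 : 8 <= k%:R :> R by rewrite ler_nat.
have q0 : 0 < q by nra.
have q7 : q <= 7^-1 by nra.
case: bound => [|bound]; first lra.
(* The second alternative has the larger leading constant; as [m >= (k - 1) * B], its surplus
   [(1/6 - q) * m] absorbs its larger additive loss. *)
suff : (3^-1 - 3 / 2 * q) * B%:R <= (6^-1 - q) * m%:R by lra.
have : (6^-1 - q) * ((k%:R - 1) * B%:R) <= (6^-1 - q) * m%:R by rewrite ler_wpM2l //; lra.
apply: le_trans; rewrite mulrA ler_wpM2r //; nra.
Qed.
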